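(* Let $R$ be a $*$-ring. Then $R$ is $*$-Boolean-like if and only if (1) $R$ is strongly nil $*$-clean, and (2) $\alpha\beta=0$ for all nilpotent elements $\alpha,\beta\in R$.
   Context: All rings are associative with unity (not necessarily commutative). An involution of a ring $R$ is a map $*:R\to R$ with $(x+y)^*=x^*+y^*$, $(xy)^*=y^*x^*$ and $(x^* )^*=x$ for all $x,y\in R$; a ring with an involution is called a $*$-ring. A projection in a $*$-ring is an element $p$ with $p^2=p=p^*$. A $*$-ring is strongly nil $*$-clean if every element is the sum of a projection and a nilpotent element that commute with each other. A $*$-ring $R$ is $*$-Boolean-like if every idempotent in $R$ is a projection and $(a-a^2)(b-b^2)=0$ for all $a,b\in R$. *)

(* Defs.v *)
From mathcomp Require Import all_boot all_algebra.

Set Implicit Arguments.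
Unset Strict Implicit.
Unset Printing Implicit Defensive.

Import GRing.Theory.
Local Open Scope ring_scope.

(* Rings are associative and unital, not necessarily commutative; pzRingType
   also includes the zero ring. *)

Definition ring_involution (R : pzRingType) (star : R -> R) : Prop :=
  [/\ forall x y : R, star (x + y) = star x + star y,
      forall x y : R, star (x * y) = star y * star x
    & forall x : R, star (star x) = x].

Definition ring_idempotent (R : pzRingType) (e : R) : Prop := e ^+ 2 = e.

Definition ring_nilpotent (R : pzRingType) (x : R) : Prop :=
  exists n : nat, x ^+ n = 0.

Definition projection (R : pzRingType) (star : R -> R) (p : R) : Prop :=
  p ^+ 2 = p /\ star p = p.

Definition strongly_nil_star_clean (R : pzRingType) (star : R -> R) : Prop :=
  forall a : R, exists p n : R,
    [/\ projection star p, ring_nilpotent n, a = p + n & p * n = n * p].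

Definition star_Boolean_like (R : pzRingType) (star : R -> R) : Prop :=
  (forall e : R, ring_idempotent e -> projection star e) /\
  (forall a b : R, (a - a ^+ 2) * (b - b ^+ 2) = 0).

(* Main.v *)
Require Import Defs.
From mathcomp Require Import all_boot all_algebra.

Import GRing.Theory.
Local Open Scope ring_scope.

(** If [(a - a^2)^2 = 0], the idempotent lifting [a] is [3a^2 - 2a^3]; it differs
    from [a] by [(a - a^2)(1 - 2a)], which squares to zero.  Conversely, when
    products of nilpotents vanish, [a = p + n] gives [a - a^2 = n(1 - 2p)], again
    nilpotent; and if [p + n] is idempotent then [n = 2pn], so [pn = 2pn] and
    [n = 0]. *)

Lemma idempotent_lift {R : pzRingType} (a : R) :
  (a - a ^+ 2) * (a - a ^+ 2) = 0 ->
  exists p : R,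
    [/\ ring_idempotent p, (a - p) ^+ 2 = 0 & p * (a - p) = (a - p) * p].
Proof.
set d := a - a ^+ 2 => dd.
have aa : a * a = a - d by rewrite /d subKr expr2.
have da : d * a = a * d by rewrite /d mulrBl mulrBr -exprSr -exprS.
(* Since a^2 = a - d and d^2 = 0, multiplying by [a] fixes [a * d]; this collapses the products of
   [a] with [y] below. *)
have aad : a * (a * d) = a * d by rewrite mulrA aa mulrBl dd subr0.
have ada : a * d * a = a * d by rewrite -mulrA da aad.
have add : a * d * d = 0 by rewrite -mulrA dd mulr0.
have dad : d * (a * d) = 0 by rewrite mulrA da add.
(* The correction y = 2ad - d is chosen so that a + y = a^2 + 2a(a - a^2) = 3a^2 - 2a^3. *)
have [y yE] : exists y, y = a * d + a * d - d by eexists.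
have ay : a * y = a * d by rewrite yE mulrBr mulrDr aad addrK.
have ya : y * a = a * d by rewrite yE mulrBl mulrDl ada da addrK.
have yd : y * d = 0 by rewrite yE mulrBl mulrDl add dd addr0 subr0.
have yy : y * y = 0.
  by rewrite {2}yE mulrBr mulrDr yd subr0 mulrA ya add addr0.
have ay_sub : a - (a + y) = - y by rewrite opprD addrA subrr sub0r.
exists (a + y); rewrite ay_sub; split.
(* The square is a^2 + 2ay = (a - d) + 2ad, which is a + y again. *)
- rewrite /ring_idempotent expr2 mulrDl !mulrDr aa ay ya yy addr0.
  by rewrite yE -!addrA (addrC (- d)) !addrA.
- by rewrite sqrrN expr2 yy.
- by rewrite mulrN mulNr mulrDl mulrDr ay ya.
Qed.

(** Iterating the equation gives x^n y = y for every n. This cancels the unit 1 - x from (1 - x)y =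
    0 without constructing its inverse. *)
Lemma nilpotent_mull_fixed {R : pzRingType} {x y : R} :
  ring_nilpotent x -> x * y = y -> y = 0.
Proof.
move=> [n xn0] xy; have <- : x ^+ n * y = y; last by rewrite xn0 mul0r.
by elim: n {xn0} => [|n IHn]; rewrite ?expr0 ?mul1r // exprSr -mulrA xy.
Qed.

Lemma nilpotent_mulr_fixed {R : pzRingType} {x y : R} :
  ring_nilpotent x -> y * x = y -> y = 0.
Proof.
move=> [n xn0] yx; have <- : y * x ^+ n = y; last by rewrite xn0 mulr0.
by elim: n {xn0} => [|n IHn]; rewrite ?expr0 ?mulr1 // exprS mulrA yx.
Qed.

(** Factor x - x^2 = (1 - x)x and y - y^2 = y(1 - y): the outer factors are units and cancel, one on
    each side. *)
Lemma nilpotent_mul_eq0 {R : pzRingType} {x y : R} :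
  ring_nilpotent x -> ring_nilpotent y ->
  (x - x ^+ 2) * (y - y ^+ 2) = 0 -> x * y = 0.
Proof.
move=> nx ny xy0.
have x_y : x * (y - y ^+ 2) = 0.
  apply: (nilpotent_mull_fixed nx); apply/esym/subr0_eq.
  by rewrite mulrA -mulrBl -expr2.
apply: (nilpotent_mulr_fixed ny); apply/esym/subr0_eq.
by rewrite -mulrA -mulrBr -expr2.
Qed.

Lemma idempotent_add_sq0 {R : pzRingType} {p n : R} :
  ring_idempotent p -> n * n = 0 -> p * n = n * p ->
  ring_idempotent (p + n) -> n = 0.
Proof.
rewrite /ring_idempotent !expr2 => pp nn pn.
rewrite mulrDl !mulrDr pp nn addr0 -pn -addrA => /addrI pn2.
have pn0 : p * n = 0.
  have := congr1 ( *%R p) pn2; rewrite mulrDr mulrA pp.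
  by move/(canRL (addrK _)); rewrite subrr.
by rewrite -pn2 pn0 addr0.
Qed.

Lemma nilpotent_sub_sqr {R : pzRingType} {p n : R} :
  ring_idempotent p -> n * n = 0 -> p * n = n * p ->
  ring_nilpotent (p + n - (p + n) ^+ 2).
Proof.
rewrite /ring_idempotent expr2 => pp nn pn; exists 2.
have -> : p + n - (p + n) ^+ 2 = n * (1 - p - p).
  rewrite expr2 mulrDl !mulrDr pp nn addr0 pn -(addrA p (n * p)).
  by rewrite !opprD addrACA subrr add0r !mulrN mulr1 addrA.
(* As n commutes with 1 - 2p, the square of their product splits off the factor n^2 = 0. *)
have np : GRing.comm n (1 - p - p).
  by do 2?apply: commrB; rewrite ?/GRing.comm ?mulr1 ?mul1r.
by rewrite exprMn_comm // expr2 nn mul0r.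
Qed.

Theorem theorem3p4 (R : pzRingType) (star : R -> R)
    (star_inv : ring_involution star) :
  star_Boolean_like star <->
  strongly_nil_star_clean star /\
  (forall alpha beta : R,
     ring_nilpotent alpha -> ring_nilpotent beta -> alpha * beta = 0).
Proof.
split=> [[idem_proj sub_sqr0] | [clean nil0]]; split.
- move=> a; have [p [pp nn pn]] := idempotent_lift a (sub_sqr0 a a).
  exists p, (a - p); split=> //; first exact: idem_proj.
    by exists 2.
  by rewrite addrC subrK.
- by move=> x y nx ny; apply: nilpotent_mul_eq0.
- move=> e ee; have [p [n [pproj nn e_eq pn]]] := clean e.
  rewrite e_eq in ee *.
  (* Condition (2) applied to the pair n, n gives n^2 = 0; once n vanishes, the idempotent is its
     own projection part. *)
  have -> : n = 0.
    by apply: idempotent_add_sq0 pn ee; [case: pproj | apply: nil0].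
  by rewrite addr0.
- move=> a b.
  (* With every c - c^2 nilpotent, the required identity becomes an instance of (2). *)
  have nil_sub (c : R) : ring_nilpotent (c - c ^+ 2).
    have [p [n [[pp _] nn -> pn]]] := clean c.
    by apply: nilpotent_sub_sqr => //; apply: nil0.
  exact: nil0.
Qed.
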